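(* For every integer $n\ge1$, the Bernoulli number $b_n$ can be written as the following fraction (a quotient of two integers): $$b_n=\frac{(n+1)!\displaystyle\sum_{k=1}^n(-1)^k\frac1{k+1}\sum_{\substack{n_1+\cdots+n_k=n\\ n_i\ge1}}\binom{n}{n_1,n_2,\dots,n_k}}{(n+1)!}.$$
   Context: The Bernoulli numbers $b_n$ ($n\ge0$) are defined by $\frac{x}{e^x-1}=\sum_{n=0}^\infty b_n\frac{x^n}{n!}$. The inner sum is over ordered $k$-tuples of positive integers $(n_1,\dots,n_k)$ with sum $n$, and $\binom{n}{n_1,\dots,n_k}=\frac{n!}{n_1!\cdots n_k!}$. *)

(* Defs.v *)
From HB Require Import structures.
From mathcomp Require Import all_boot all_order all_algebra.
From mathcomp Require Import all_classical all_reals all_analysis.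
Set Implicit Arguments.
Unset Strict Implicit.
Unset Printing Implicit Defensive.
Import Order.TTheory GRing.Theory Num.Theory.
Import numFieldNormedType.Exports.
Local Open Scope classical_set_scope.
Local Open Scope ring_scope.

(* x / (e^x - 1) = \sum_n b_n x^n / n! as convergent series for x near 0.
   The neighborhood is punctured because x / (expR x - 1) has a removable
   singularity at 0 (with limit 1), where the term below evaluates to 0. *)
Definition bernoulli_numbers (R : realType) (b : nat -> R) : Prop :=
  \forall x \near (0 : R)^',
    pseries (fun n => b n / n`!%:R) x @ \oo --> x / (expR x - 1).

(* Entries of a composition of n are at most n, so they range over 'I_n.+1. *)
Definition composition (n k : nat) (t : {ffun 'I_k -> 'I_n.+1}) : bool :=
  [forall i, 0 < t i]%N && (\sum_i t i == n)%N.

Definition multinomial (R : realType) (n k : nat)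
    (t : {ffun 'I_k -> 'I_n.+1}) : R :=
  n`!%:R / \prod_i (t i)`!%:R.

Definition bernoulli_numerator (R : realType) (n : nat) : R :=
  (n.+1)`!%:R *
  \sum_(1 <= k < n.+1)
    (-1) ^+ k * (1 / k.+1%:R) *
    \sum_(t : {ffun 'I_k -> 'I_n.+1} | composition t) multinomial R t.

(* Main.v *)
Require Import Defs.
From mathcomp Require Import all_boot all_order all_algebra.
From mathcomp Require Import all_classical all_reals all_analysis.
From mathcomp Require Import ring lra.
Import Order.TTheory GRing.Theory Num.Theory.
Local Open Scope ring_scope.

(* Write E = e^x - 1, as a power series truncated at a high order n.  Since
   E' = 1 + E, log(1 + E) = \sum_k (-1)^k E^(k+1) / (k+1) has derivative 1, so
   E * \sum_k (-1)^k E^k / (k+1) = x up to order n.  On the analytic side, a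
   power series is approximated near 0 by its truncation up to O(x^n), so
   E * \sum_i (b_i / i!) x^i - x is O(x^n), hence divisible by x^n as a
   polynomial.  Cancelling E gives
   b_n / n! = \sum_k (-1)^k / (k+1) [x^n] E^k,
   and expanding E^k yields the sum over compositions. *)

(** * Congruences modulo powers of X for the truncated exponential *)

Section TruncatedExponential.
Variable F : numFieldType.
Implicit Types (p q : {poly F}) (n k : nat).

Lemma dvdXnP n p : reflect (forall i, (i < n)%N -> p`_i = 0) ('X^n %| p).
Proof.
apply: (iffP idP) => [/dvdpP[q ->] i lt_in|p0]; first by rewrite coefMXn lt_in.
rewrite -(poly_take_drop n p); suff -> : take_poly n p = 0.
  by rewrite add0r dvdp_mulIr.
apply/polyP => i; rewrite coef_take_poly coef0.
by case: ifP => // /p0.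
Qed.

Lemma dvdXn_deriv n p : p`_0 = 0 -> 'X^n %| p^`() -> 'X^(n.+1) %| p.
Proof.
move=> p0 /dvdXnP dp; apply/dvdXnP => -[//|i] lt_in.
have /eqP := dp i lt_in; rewrite coef_deriv mulrn_eq0 /= => /eqP //.
Qed.

Definition expm1_poly n : {poly F} :=
  \poly_(i < n) (if i == 0%N then 0 else (i`!%:R)^-1).

Lemma coef_expm1_poly n i : (i < n)%N ->
  (expm1_poly n)`_i = if i == 0%N then 0 else (i`!%:R)^-1.
Proof. by move=> lt_in; rewrite coef_poly lt_in. Qed.

Lemma expm1_poly0 n : (expm1_poly n)`_0 = 0.
Proof. by rewrite coef_poly eqxx if_same. Qed.

Lemma dvdX_expm1_poly n : 'X %| expm1_poly n.
Proof.
by rewrite -['X]expr1; apply/dvdXnP => -[|//] _; exact: expm1_poly0.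
Qed.

(** Truncation breaks E' = 1 + E only in the top term, X^(n+1)/(n+1)!, which the derivative no
    longer reaches. *)
Lemma deriv_expm1_poly n :
  'X^(n.+1) %| (expm1_poly n.+2)^`() - (1 + expm1_poly n.+2).
Proof.
apply/dvdXnP => i lt_in.
rewrite coefB coefD coef_deriv !coef_expm1_poly //; last exact: ltnW.
have inv_fact : (i.+1`!%:R)^-1 *+ i.+1 = (i`!%:R)^-1 :> F.
  by rewrite factS natrM invfM -[LHS]mulr_natr mulrAC mulVf ?mul1r //.
rewrite /= inv_fact coef1; case: eqP => [->|_] /=.
  by rewrite fact0 invr1 addr0 subrr.
by rewrite add0r subrr.
Qed.

Lemma coprime_Xn_expm1_poly n m : coprimep 'X^n (1 + expm1_poly m).
Proof.
apply: coprimep_expl; rewrite coprimep_sym coprimepX /root hornerD hornerC.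
by rewrite horner_coef0 expm1_poly0 addr0 oner_eq0.
Qed.

Lemma log_expm1_poly n : 'X^(n.+2) %|
  expm1_poly n.+2 * \sum_(k < n.+1) ((-1) ^+ k / k.+1%:R) *: expm1_poly n.+2 ^+ k
  - 'X.
Proof.
set E := expm1_poly n.+2.
apply: dvdXn_deriv.
  by rewrite coefB coefX coefM big_ord1 expm1_poly0 mul0r subr0.
rewrite mulr_sumr derivB derivX [deriv (\sum_(_ < _) _)]raddf_sum.
under eq_bigr => k _.
  rewrite /= -scalerAr -exprS derivZ deriv_exp /= -scaler_nat scalerA.
  rewrite divfK ?pnatr_eq0 // scalerAr -[_ *: _]mul_polyC rmorphXn rmorphN1.
  rewrite -exprMn mulN1r.
over.
(* The derivative is now E' times a geometric sum in -E, minus 1. Multiplying by 1 + E, a unit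
   modulo X^(n+1), telescopes that sum and leaves a remainder containing E^(n+1), which X^(n+1)
   divides. *)
rewrite -mulr_sumr -(Gauss_dvdpr _ (coprime_Xn_expm1_poly n.+1 n.+2)) -/E.
have geom : (1 + E) * \sum_(i < n.+1) (- E) ^+ i = 1 - (- E) ^+ n.+1.
  by rewrite -[RHS]opprB subrX1 -mulNr; congr (_ * _); rewrite opprB opprK.
have -> : (1 + E) * (E^`() * (\sum_(i < n.+1) (- E) ^+ i) - 1) =
    (E^`() - (1 + E)) - (- E) ^+ n.+1 * E^`().
  by rewrite mulrBr mulrCA geom; ring.
apply: dvdp_sub; first exact: deriv_expm1_poly.
rewrite dvdp_mulr // dvdp_exp2r // -scaleN1r dvdpZr ?oppr_eq0 ?oner_eq0 //.
exact: dvdX_expm1_poly.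
Qed.

(** E = e X with e(0) = 1, so e is a unit modulo powers of X, and cancelling E costs exactly one
    power of X. *)
Lemma expm1_poly_cancel n p q :
  'X^(n.+2) %| expm1_poly n.+2 * p - 'X -> 'X^(n.+2) %| expm1_poly n.+2 * q - 'X ->
  'X^(n.+1) %| p - q.
Proof.
move=> dp dq; have := dvdp_sub dp dq.
rewrite opprB addrA subrK -mulrBr.
have /dvdpP[e def_e] := dvdX_expm1_poly n.+2.
have e0 : e`_0 = 1.
  have := coef_expm1_poly n.+2 1 isT.
  by rewrite def_e coefMX /= invr1.
rewrite def_e (mulrC e) -mulrA exprS dvdp_mul2l ?polyX_eq0 // Gauss_dvdpr //.
apply: coprimep_expl; rewrite coprimep_sym coprimepX /root.
by rewrite horner_coef0 e0 oner_eq0.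
Qed.

Lemma expm1_poly_inverse_coef n p :
  'X^(n.+2) %| expm1_poly n.+2 * p - 'X ->
  p`_n = \sum_(k < n.+1) (-1) ^+ k / k.+1%:R * (expm1_poly n.+1 ^+ k)`_n.
Proof.
move=> /expm1_poly_cancel/(_ (log_expm1_poly n))/dvdXnP/(_ n (ltnSn n)).
move=> /eqP; rewrite coefB subr_eq0 coef_sum => /eqP ->.
apply: eq_bigr => k _; rewrite coefZ; congr (_ * _).
(* The two truncations of E agree below degree n + 1, and a difference of k-th powers is a multiple
   of the difference of the bases. *)
apply/eqP; rewrite -subr_eq0 -coefB; apply/eqP; move: (ltnSn n); apply/dvdXnP.
rewrite subrXX dvdp_mulr //; apply/dvdXnP => i lt_in.
by rewrite coefB !coef_expm1_poly ?subrr // ltnW.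
Qed.

End TruncatedExponential.

(** * Compositions, multinomial coefficients and integrality *)

Lemma coef_expm1_poly_exp (R : realType) n k :
  n`!%:R * (expm1_poly R n.+1 ^+ k)`_n =
  \sum_(t : {ffun 'I_k -> 'I_n.+1} | composition t) multinomial R t.
Proof.
rewrite /expm1_poly poly_def -(card_ord k) -prodr_const card_ord.
(* Distributivity yields one monomial, of degree [\sum_i t i], for each function [t]. A [t] with a
   zero entry contributes 0, because E has no constant term. *)
rewrite bigA_distr_bigA /= coef_sum mulr_sumr [RHS]big_mkcond.
apply: eq_bigr => t _; rewrite scaler_prod prodrXr coefZ coefXn /composition.
case: forallP => [t_gt0|t_eq0] /=.
  rewrite eq_sym; case: eqP => _ /=; last by rewrite !mulr0.
  rewrite mulr1 /multinomial -prodfV; congr (_ * _); apply: eq_bigr => i _.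
  by rewrite -[_ == _]negbK -lt0n t_gt0.
case: (pickP (fun i => t i == 0 :> nat)) => [i /= ti0|t_neq0].
  by rewrite (bigD1 i) //= ti0 !mul0r mulr0.
by case: t_eq0 => i; rewrite lt0n t_neq0.
Qed.

(** Splitting off one entry at a time leaves a binomial coefficient as quotient. *)
Lemma dvdn_prod_fact k (t : 'I_k -> nat) :
  (\prod_i (t i)`! %| (\sum_i t i)`!)%N.
Proof.
elim/big_rec2: _ => // i p s _ dvd_ps.
apply: dvdn_trans (dvdn_mul (dvdnn _) dvd_ps) _.
by rewrite -(bin_fact (leq_addr p (t i))) addKn dvdn_mull.
Qed.

Lemma bernoulli_numerator_int (R : realType) n :
  bernoulli_numerator R n \is a Num.int.
Proof.
rewrite /bernoulli_numerator mulr_sumr big_nat; apply: rpred_sum => k /andP[_ lt_kn].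
have div_int m d : (d != 0)%N -> (d %| m)%N -> m%:R / d%:R \is a @Num.int R.
  by move=> d0 dvd_dm; rewrite -natr_div ?unitfE ?pnatr_eq0 // natr_int.
rewrite mulrA mulrCA -mulrA mul1r rpredM ?rpredX ?rpredN1 //.
rewrite rpredM ?div_int ?dvdn_fact //.
apply: rpred_sum => t /andP[_ /eqP sum_t].
rewrite /multinomial -natr_prod div_int //; last by rewrite -[X in X`!]sum_t dvdn_prod_fact.
by rewrite -lt0n prodn_gt0 // => i; rewrite fact_gt0.
Qed.

(** * From convergent power series to polynomial divisibility *)

Import numFieldNormedType.Exports.
Local Open Scope classical_set_scope.
Local Open Scope ring_scope.

Lemma geometric_sum_le2 (R : realFieldType) (q : R) m :
  0 <= q <= 2^-1 -> \sum_(i < m) q ^+ i <= 2.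
Proof.
move=> /andP[q0 q2]; elim: m => [|m IHm]; first by rewrite big_ord0.
rewrite big_ord_recl expr0; under eq_bigr do rewrite exprS.
rewrite -mulr_sumr.
have sum_ge0 : 0 <= \sum_(i < m) q ^+ i
  by apply: sumr_ge0 => i _; exact: exprn_ge0.
by have := ler_pM q0 sum_ge0 q2 IHm; rewrite mulVf ?pnatr_eq0 //; lra.
Qed.

(** Convergence at [x0] bounds the terms there by some M. For |x| <= |x0|/2 the tail is then at most
    M q^n times a geometric sum of ratio q = |x|/|x0| <= 1/2, hence the factor 2 in the constant. *)
Lemma pseries_remainder (R : realType) (a : R ^nat) (x0 : R) n :
    x0 != 0 -> cvgn (pseries a x0) ->
  exists C, \forall x \near 0, forall l, pseries a x @ \oo --> l ->
    `|(\poly_(i < n) a i).[x] - l| <= C * `|x| ^+ n.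
Proof.
move=> x0_neq0 cvg_x0; have x0_gt0 : 0 < `|x0| by rewrite normr_gt0.
have [M M_gt0 bound_a] : exists2 M, 0 < M & forall i, `|a i| * `|x0| ^+ i <= M.
  have /cvgP/cvg_seq_bounded[M0 [_ bound]] := @cvg_series_cvg_0 _ _ _ cvg_x0.
  exists (`|M0| + 1) => [|i]; first by rewrite ltr_wpDl.
  rewrite -normrX -normrM; apply: bound => //.
  by rewrite ltr_pwDr ?ler_norm.
exists (M / `|x0| ^+ n * 2).
have : \forall x \near (0 : R), `|x| <= `|x0| / 2.
  by apply: nbhs0_le; rewrite divr_gt0.
apply: filterS => x x_small l cvg_l.
pose q := `|x| / `|x0|.
have q_ge0 : 0 <= q by rewrite divr_ge0.
have q_le : q <= 2^-1 by rewrite ler_pdivrMr // mulrC.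
have tail m : `|\sum_(i < n) a i * x ^+ i - pseries a x (n + m)%N| <=
    M / `|x0| ^+ n * 2 * `|x| ^+ n.
  rewrite /pseries /series /= big_mkord big_split_ord /= opprD addrA subrr sub0r normrN.
  apply: le_trans (ler_norm_sum _ _ _) _.
  have -> : M / `|x0| ^+ n * 2 * `|x| ^+ n = M * q ^+ n * 2.
    by rewrite expr_div_n; ring.
  have q_sum : \sum_(i < m) q ^+ i <= 2 by apply: geometric_sum_le2; rewrite q_ge0.
  apply: le_trans (_ : M * q ^+ n * \sum_(i < m) q ^+ i <= _); last first.
    by rewrite ler_wpM2l // mulr_ge0 ?exprn_ge0 // ltW.
  rewrite mulr_sumr; apply: ler_sum => i _.
  rewrite -mulrA -exprD expr_div_n mulrCA normrM normrX mulrC ler_wpM2l ?exprn_ge0 //.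
  by rewrite ler_pdivlMr ?exprn_gt0.
rewrite horner_poly.
(* The bound [tail] is uniform in [m], so it passes to the limit. *)
apply: cvgr_to_le (cvg_norm (cvgB (cvg_cst (\sum_(i < n) a i * x ^+ i)) cvg_l)) _.
exists n => // m /= le_nm; rewrite -(subnKC le_nm); exact: tail.
Qed.

(** Write p = q X^m with q(0) nonzero. If m < n, dividing the bound by |x|^m gives |q(x)| <= C
    |x|^(n-m), which forces q(0) = 0 in the limit. *)
Lemma horner_small_dvdXn (R : realType) (p : {poly R}) n C :
    (\forall x \near 0^', `|p.[x]| <= C * `|x| ^+ n) ->
  'X^n %| p.
Proof.
move=> small_p; have [->|p_neq0] := eqVneq p 0; first exact: dvdp0.
have [m [q]] := multiplicity_XsubC p 0; rewrite p_neq0 /= subr0 => q0 def_p.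
rewrite def_p; apply: dvdp_mull; rewrite dvdp_Pexp2l ?size_polyX //.
rewrite leqNgt; apply: contra q0 => lt_mn; rewrite /root -normr_le0.
have cvg_q : `|q.[x]| @[x --> 0^'] --> `|q.[0]|.
  by apply: cvg_norm; apply: cvg_within_filter; exact: continuous_horner.
have cvg_0 : (C *: 'X^(n - m)).[`|x|] @[x --> (0 : R)^'] --> (0 : R).
  have lim_eq : (C *: 'X^(n - m)).[`|0 : R|] = 0.
    by rewrite normr0 hornerZ hornerXn expr0n subn_eq0 leqNgt lt_mn mulr0.
  rewrite -[X in _ --> X]lim_eq; apply: cvg_within_filter.
  exact: cvg_comp (@norm_continuous _ _ (0 : R)) (@continuous_horner _ _ _).
apply: ler_cvg_to cvg_q cvg_0 _.
near=> x.
have x_gt0 : 0 < `|x| by rewrite normr_gt0; near: x; exact: nbhs_dnbhs_neq.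
rewrite hornerZ hornerXn -(ler_pM2r (exprn_gt0 m x_gt0)) -mulrA -exprD subnK.
  rewrite -normrX -normrM -hornerXn -hornerM -def_p; near: x; exact: small_p.
exact: ltnW.
Unshelve. all: by end_near. Qed.

Lemma bernoulli_gf_poly (R : realType) (b : nat -> R) n : bernoulli_numbers b ->
  'X^(n.+2) %| expm1_poly R n.+2 * \poly_(i < n.+2) (b i / i`!%:R) - 'X.
Proof.
move=> hb; set E := expm1_poly R n.+2; set A := \poly_(i < _) _.
have exp_cvg (x : R) : pseries (fun i => i`!%:R^-1) x @ \oo --> expR x.
  rewrite (_ : pseries _ x = series (exp_coeff x)).
    exact: is_cvg_series_exp_coeff.
  by apply/funext => m; apply: eq_bigr => i _; rewrite /exp_coeff /= mulrC.
have [C1 exp_near] := @pseries_remainder R _ 1 n.+2 (oner_neq0 _) (cvgP _ (exp_cvg 1)).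
have [C2 b_near] : exists C, \forall x \near 0,
    forall l, pseries (fun i => b i / i`!%:R) x @ \oo --> l ->
      `|A.[x] - l| <= C * `|x| ^+ n.+2.
  (* The punctured neighborhood filter is proper, so it supplies a nonzero point of convergence. *)
  have [x0 [x0_neq0 cvg_x0]] := filter_ex (filterI (nbhs_dnbhs_neq (0 : R)) hb).
  exact: pseries_remainder x0_neq0 (cvgP _ cvg_x0).
have A_near : \forall x \near (0 : R), `|A.[x]| <= `|A.[0]| + 1.
  apply: (cvgr_le _ (cvg_norm (@continuous_horner _ A 0))).
  by rewrite ltrDl.
have e_near : \forall x \near (0 : R), `|expR x - 1| <= 1.
  have e_cvg : `|expR x - 1| @[x --> (0 : R)] --> `|expR (0 : R) - 1|.
    by apply: cvg_norm; apply: cvgB; [exact: continuous_expR|exact: cvg_cst].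
  apply: (cvgr_le _ e_cvg).
  by rewrite expR0 subrr normr0.
have E_poly : \poly_(i < n.+2) i`!%:R^-1 = 1 + E.
  apply/polyP => -[|i]; rewrite coefD coef1 !coef_poly /= ?addr0 ?invr1 //.
  by case: ifP; rewrite add0r.
rewrite E_poly in exp_near.
apply: (@horner_small_dvdXn _ _ _ (`|C1| * (`|A.[0]| + 1) + `|C2|)).
near=> x.
have x_neq0 : x != 0 by near: x; exact: nbhs_dnbhs_neq.
have e_neq0 : expR x - 1 != 0.
  by rewrite subr_eq0 -expR0; apply: contra x_neq0 => /eqP/expR_inj ->.
have E_le : `|E.[x] - (expR x - 1)| <= `|C1| * `|x| ^+ n.+2.
  have -> : E.[x] - (expR x - 1) = (1 + E).[x] - expR x.
    by rewrite hornerD hornerC; ring.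
  apply: le_trans (_ : C1 * `|x| ^+ n.+2 <= _).
    exact: (near (nbhs_dnbhs exp_near) x).
  by rewrite ler_wpM2r ?exprn_ge0 ?ler_norm.
have A_le : `|A.[x] - x / (expR x - 1)| <= `|C2| * `|x| ^+ n.+2.
  apply: le_trans (_ : C2 * `|x| ^+ n.+2 <= _).
    exact: (near (nbhs_dnbhs b_near) x _ _ (near hb x _)).
  by rewrite ler_wpM2r ?exprn_ge0 ?ler_norm.
have A_bound : `|A.[x]| <= `|A.[0]| + 1 by near: x; exact: nbhs_dnbhs.
have e_bound : `|expR x - 1| <= 1 by near: x; exact: nbhs_dnbhs.
rewrite hornerD hornerM hornerN hornerX.
(* Each truncation error is multiplied by a factor bounded near 0: |A(x)| <= |A(0)| + 1 and |e^x -
   1| <= 1. This explains the constant chosen above. *)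
have -> : E.[x] * A.[x] - x = (E.[x] - (expR x - 1)) * A.[x]
    + (expR x - 1) * (A.[x] - x / (expR x - 1)) by field.
apply: le_trans (ler_normD _ _) _; rewrite !normrM mulrDl.
apply: lerD; first by rewrite [leRHS]mulrAC ler_pM.
by rewrite -[leRHS]mul1r ler_pM.
Unshelve. all: by end_near. Qed.

Theorem corollary2p22 (R : realType) (b : nat -> R)
    (hb : bernoulli_numbers b) (n : nat) (hn : (1 <= n)%N) :
  bernoulli_numerator R n \is a Num.int /\
  b n = bernoulli_numerator R n / (n.+1)`!%:R.
Proof.
split; first exact: bernoulli_numerator_int.
have fact_neq0 m : m`!%:R != 0 :> R by rewrite pnatr_eq0 -lt0n fact_gt0.
have /expm1_poly_inverse_coef := @bernoulli_gf_poly R b n hb.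
rewrite coef_poly ltnW // => /(canRL (divfK (fact_neq0 n))) ->.
rewrite /bernoulli_numerator [RHS]mulrAC divff // mul1r.
(* The k = 0 term is the coefficient of X^n in E^0 = 1, which vanishes since n >= 1. *)
rewrite big_ord_recl expr0 coef1 eqn0Ngt hn mulr0 add0r.
rewrite big_add1 big_mkord mulr_suml; apply: eq_bigr => k _.
by rewrite -coef_expm1_poly_exp mul1r -!mulrA [_ * n`!%:R]mulrC.
Qed.
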